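(* Let $r$ and $s$ be positive integers and let $G$ be a finite simple graph of order $n=3r+4s$ with $\sigma_{2}(G)\geq n+r$. Then $G$ contains $r$ triangles, $s-1$ quadrilaterals and a subgraph $D$ of order four with at least four edges, all pairwise vertex-disjoint (i.e. $G\supseteq rC_{3}\cup(s-1)C_{4}\cup D$).
   Context: All graphs are finite, simple and undirected. For a graph $G$, $\sigma_{2}(G)=\min\{d(x)+d(y): x,y\in V(G),\ x\neq y,\ xy\notin E(G)\}$, where $d(v)$ is the degree of $v$; if $G$ is complete, $\sigma_2(G)=\infty$. $C_k$ denotes a cycle with $k$ vertices; $C_3$ is a triangle and $C_4$ a quadrilateral. $mQ$ denotes $m$ vertex-disjoint copies of $Q$, and $G\supseteq A\cup B$ means $G$ contains vertex-disjoint subgraphs isomorphic to $A$ and $B$ (not necessarily induced). *)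

(* Defs.v *)
From mathcomp Require Import all_boot.
Set Implicit Arguments. Unset Strict Implicit. Unset Printing Implicit Defensive.

Definition simple_graph (T : finType) (e : rel T) : Prop :=
  symmetric e /\ irreflexive e.

Definition deg (T : finType) (e : rel T) (x : T) : nat := #|[set y | e x y]|.

(* sigma_2(G) >= k : every pair of distinct non-adjacent vertices has
   degree sum at least k (vacuous for complete graphs, sigma_2 = infinity). *)
Definition sigma2_ge (T : finType) (e : rel T) (k : nat) : Prop :=
  forall x y : T, x != y -> ~~ e x y -> k <= deg e x + deg e y.

(* t : 'I_3 -> T spans a triangle (distinctness handled by global injectivity) *)
Definition is_triangle (T : finType) (e : rel T) (t : 'I_3 -> T) : Prop :=
  forall j k : 'I_3, j != k -> e (t j) (t k).

Definition is_quad (T : finType) (e : rel T) (q : 'I_4 -> T) : Prop :=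
  forall j : 'I_4, e (q j) (q (ordS j)).

Definition edges4 (T : finType) (e : rel T) (d : 'I_4 -> T) : nat :=
  #|[set p : 'I_4 * 'I_4 | (p.1 < p.2) && e (d p.1) (d p.2)]|.

(* combined labelling of all vertices used by the r triangles,
   the m quadrilaterals and D; its injectivity = pairwise vertex-disjointness
   and distinctness of vertices within each piece. *)
Definition all_vertices (T : finType) (r m : nat)
  (t : 'I_r -> 'I_3 -> T) (q : 'I_m -> 'I_4 -> T) (d : 'I_4 -> T)
  (u : ('I_r * 'I_3) + (('I_m * 'I_4) + 'I_4)) : T :=
  match u with
  | inl (i, j) => t i j
  | inr (inl (i, j)) => q i j
  | inr (inr j) => d j
  end.

(* Main.v *)
Require Import Defs.
From mathcomp Require Import all_boot zify.
Set Implicit Arguments. Unset Strict Implicit. Unset Printing Implicit Defensive.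

(** Write [n + r = 4 (r + s)].  Partition the vertices into triangles,
    quadrilaterals and a small leftover [W].  If [X] is a multiset of vertices
    of [W] that splits into nonadjacent pairs, its degree sum is at least
    [2 |X|] per piece on average, so as soon as [W] itself receives few edges
    from [X], some triangle or quadrilateral receives more than [2 |X|] edges
    from [X]; such a dense pair (piece, [W]) can be rearranged.

    - If all [r] triangles and [s - 1] quadrilaterals are present, the four
      leftover vertices can be improved step by step: no edge, [K2], [2K2],
      [P3], [K13], [P4], triangle, and finally [C4] or a paw.
    - In general add a missing edge and use induction on the number of missing
      edges.  Deleting the edge again breaks at most one piece.  A broken
      quadrilateral leaves two disjoint [P4]'s, and a piece receiving at least
      17 edges from these eight vertices yields one more quadrilateral.  A
      broken triangle leaves a path [x y z] whose vertices have at most two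
      neighbours in each quadrilateral (otherwise a triangle appears), so the
      density sits in the triangles and two of them can be rearranged with the
      path into three triangles.

    The rearrangements of a dense pair are finitely many and are verified by
    computation. *)

(** * Finite search for rearrangements *)

Definition edge := (nat * nat)%type.

Fixpoint shorter (A B : Type) (s : seq A) (t : seq B) : bool :=
  match s, t with
  | _, [::] => false
  | [::], _ => true
  | _ :: s', _ :: t' => shorter s' t'
  end.

Fixpoint shortest (A : Type) (p : seq A) (ps : seq (seq A)) : seq A :=
  if ps is q :: ps' then shortest (if shorter q p then q else p) ps' else p.

(** Nested conditionals replace Boolean connectives, here and in [branch], so that call-by-value
    evaluation stops as soon as the answer is known. *)
Fixpoint edge_in (x : edge) (s : seq edge) : bool :=
  if s is y :: s' then
    if eqn x.1 y.1 && eqn x.2 y.2 then true else edge_in x s'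
  else false.

Fixpoint edge_rem (x : edge) (s : seq edge) : seq edge :=
  if s is y :: s' then
    if eqn x.1 y.1 && eqn x.2 y.2 then s' else y :: edge_rem x s'
  else [::].

Lemma edge_inE x s : edge_in x s = (x \in s).
Proof.
elim: s => //= y s ->; rewrite in_cons.
by have -> : eqn x.1 y.1 && eqn x.2 y.2 = (x == y) by []; case: eqP.
Qed.

Lemma edge_remE x s : edge_rem x s = rem x s.
Proof.
elim: s => //= y s ->; rewrite [y == x]eq_sym.
by have -> : eqn x.1 y.1 && eqn x.2 y.2 = (x == y) by [].
Qed.

Fixpoint branch (rec : nat -> seq (seq edge) -> bool) (w : edge -> nat)
    (p : seq edge) (b : nat) (ps : seq (seq edge)) : bool :=
  if p is x :: p' then
    if (if w x <= b then rec (b - w x) [seq q <- ps | ~~ edge_in x q] else true)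
    then branch rec w p' b [seq edge_rem x q | q <- ps] else false
  else true.

(* Does every edge set whose missing edges have total weight at most [b] contain
   one of the patterns [ps]?  Some edge of a shortest pattern must be missing;
   branch on the first such edge.  Patterns only list their undecided edges. *)
Fixpoint solve (w : edge -> nat) (fuel b : nat) (ps : seq (seq edge)) : bool :=
  if fuel is fuel'.+1 then
    if ps is p :: ps' then branch (solve w fuel') w (shortest p ps') b ps else false
  else false.

Lemma shortest_in (A : eqType) (p : seq A) ps : shortest p ps \in p :: ps.
Proof.
elim: ps p => [|q ps IH] p /=; first exact: mem_head.
have := IH (if shorter q p then q else p); rewrite !in_cons.
by case: ifP => _ /orP[] ->; rewrite ?orbT.
Qed.

Section SolveSound.
Variables (w : edge -> nat) (val : edge -> bool) (G : Prop).

Definition missing (U : seq edge) := \sum_(x <- U) w x * ~~ val x.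

(** Edges known to be present have been erased from the patterns, so the remaining ones alone must
    force the goal [G]. *)
Definition covers (U : seq edge) (ps : seq (seq edge)) :=
  forall p, p \in ps -> {subset p <= U} /\ (all val p -> G).

Lemma branch_sound (rec : nat -> seq (seq edge) -> bool) (U : seq edge) b ps
    (p : seq edge) :
  (forall U b ps, uniq U -> covers U ps -> missing U <= b -> rec b ps -> G) ->
  uniq U -> covers U ps -> missing U <= b -> {subset p <= U} ->
  (all val p -> G) -> branch rec w p b ps -> G.
Proof.
move=> recP; elim: p ps => [|x p IH] ps uU cU mU pU pG /=; first by move=> _; apply: pG.
have xU : x \in U by apply: pU; rewrite mem_head.
case: ifP => // hx hb.
have [vx|vx] := boolP (val x).
  apply: (IH _ uU _ mU _ _ hb).
  - move=> q /mapP[q' q'ps ->]; have [sq gq] := cU _ q'ps.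
    rewrite edge_remE; split=> [y /mem_rem /sq //|hq]; apply: gq.
    have [xq|xq] := boolP (x \in q'); last by rewrite rem_id in hq.
    by rewrite (perm_all _ (perm_to_rem xq)) /= vx.
  - by move=> y yp; apply: pU; rewrite in_cons yp orbT.
  - by move=> hp; apply: pG; rewrite /= vx.
(* A missing [x] uses up [w x] of the budget, so the test in [branch] succeeds and the rest of [U]
   misses at most [b - w x]. *)
have mE : missing U = w x + missing (rem x U).
  by rewrite /missing (perm_big _ (perm_to_rem xU)) /= big_cons vx muln1.
move: hx; rewrite (_ : w x <= b) ?(leq_trans _ mU) ?mE ?leq_addr // => hrec.
apply: (recP (rem x U) _ _ (rem_uniq _ uU) _ _ hrec); last by rewrite leq_subRL; lia.
move=> q; rewrite mem_filter edge_inE => /andP[xq qps].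
have [sq gq] := cU _ qps; split=> // y yq; rewrite mem_rem_uniq // inE sq // andbT.
by apply: contraNneq xq => <-.
Qed.

Lemma solve_sound fuel (U : seq edge) b ps :
  uniq U -> covers U ps -> missing U <= b -> solve w fuel b ps -> G.
Proof.
elim: fuel U b ps => //= fuel IH U b [//|p ps] uU cU mU.
have [sU sG] := cU _ (shortest_in p ps).
exact: (branch_sound IH uU cU mU sU sG).
Qed.
End SolveSound.

(** * Placing disjoint subgraphs on a vertex set *)

Fixpoint splits (A : Type) (k : nat) (s : seq A) : seq (seq A * seq A) :=
  if s is x :: s' then
    (if k is k'.+1 then [seq (x :: p.1, p.2) | p <- splits k' s'] else [::])
      ++ [seq (p.1, x :: p.2) | p <- splits k s']
  else if k is 0 then [:: ([::], [::])] else [::].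

Lemma splitsP (A : eqType) k (s : seq A) p :
  p \in splits k s -> size p.1 = k /\ perm_eq (p.1 ++ p.2) s.
Proof.
elim: s k p => [|x s IH] [|k] p //=.
- by rewrite inE => /eqP ->.
- move=> /mapP[q /IH [sq pq] ->] /=; split=> //.
  by rewrite -cat_rcons -cats1 -catA perm_catCA perm_cons.
rewrite mem_cat => /orP[] /mapP[q /IH [sq pq] ->] /=; rewrite ?sq ?perm_cons //; split=> //.
by rewrite -cat_rcons -cats1 -catA perm_catCA perm_cons.
Qed.

(* A subgraph pattern on positions [0 .. psize - 1], with one arrangement of
   the positions for each of its distinct placements on a given vertex set. *)
Record part := Part { psize : nat; parrs : seq (seq nat); pedges : seq edge }.

Definition part_ok (p : part) :=
  all (perm_eq^~ (iota 0 (psize p))) (parrs p) &&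
  all (fun x => (x.1 < psize p) && (x.2 < psize p)) (pedges p).

(** Endpoints are put in increasing order, the form in which the searches list their edges. *)
Definition place (l : seq nat) (es : seq edge) : seq edge :=
  [seq (let a := nth 0 l x.1 in let b := nth 0 l x.2 in
        if a < b then (a, b) else (b, a)) | x <- es].

Definition look (m : seq (seq bool)) (x : edge) : bool :=
  nth false (nth [::] m x.1) x.2.

Definition table (n : nat) (s : seq edge) : seq (seq bool) :=
  [seq [seq edge_in (i, j) s | j <- iota 0 n] | i <- iota 0 n].

Lemma lookP n s x : look (table n s) x -> x \in s.
Proof.
case: x => i j; rewrite /look /table /=.
have [hi|hi] := ltnP i n; last by rewrite [nth _ _ i]nth_default ?nth_nil // size_map size_iota.
rewrite (nth_map 0) ?size_iota // nth_iota //.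
have [hj|hj] := ltnP j n; last by rewrite nth_default // size_map size_iota.
by rewrite (nth_map 0) ?size_iota // nth_iota // edge_inE.
Qed.

Section Embed.
Variables base vars : seq (seq bool).

(* For each placement of the disjoint parts [ps] on [vs], the edges of [vars] that
   it needs besides those of [base]. *)
Fixpoint embed (ps : seq part) (vs : seq nat) : seq (seq edge) :=
  if ps is p :: ps' then
    flatten [seq
      flatten [seq (let es := place [seq nth 0 cr.1 i | i <- arr] (pedges p) in
                    if all (fun x => look base x || look vars x) es then
                      let new := [seq x <- es | ~~ look base x] in
                      [seq new ++ es' | es' <- embed ps' cr.2]
                    else [::])
              | arr <- parrs p]
      | cr <- splits (psize p) vs]
  else [:: [::]].
End Embed.

(** The parts occupy consecutive blocks of [l]; whatever follows them is the new leftover. *)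
Fixpoint realize (T : Type) (x0 : T) (e : rel T) (ps : seq part) (l : seq T) : bool :=
  if ps is p :: ps' then
    all (fun x => e (nth x0 (take (psize p) l) x.1) (nth x0 (take (psize p) l) x.2))
        (pedges p)
    && realize x0 e ps' (drop (psize p) l)
  else true.

Lemma perm_arrange (A : eqType) (x0 : A) (c : seq A) arr :
  perm_eq arr (iota 0 (size c)) -> perm_eq [seq nth x0 c i | i <- arr] c.
Proof. by move=> /(perm_map (nth x0 c)); rewrite map_nth_iota0 // take_size. Qed.

Section EmbedSound.
Variables (T : eqType) (x0 : T) (e : rel T) (f : nat -> T).
Hypothesis e_sym : symmetric e.
Let val (x : edge) := e (f x.1) (f x.2).

Lemma embed_sound base vars ps vs es :
  (forall x, look base x -> val x) -> all part_ok ps ->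
  es \in embed base vars ps vs ->
  {subset es <= [pred x | look vars x]} /\
  (all val es -> exists l, perm_eq l (map f vs) /\ realize x0 e ps l).
Proof.
move=> baseP; elim: ps vs es => [|p ps IH] vs es /=.
  by move=> _; rewrite inE => /eqP ->; split=> // _; exists (map f vs).
move=> /andP[/andP[/allP okA /allP okE] okps].
move=> /flattenP[s1 /mapP[[c r] /splitsP /= [sc pcr] ->]].
move=> /flattenP[s2 /mapP[arr /okA parr ->]].
set l1 := [seq nth 0 c i | i <- arr].
case: ifP => // /allP allowed /mapP[es' /(IH _ _ okps) [sub' IHes] ->].
split=> [x|].
  rewrite mem_cat mem_filter => /orP[/andP[nb /allowed]|/sub' //].
  by rewrite (negPf nb).
rewrite all_cat => /andP[/allP new /IHes [l [pl rl]]].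
have pl1 : perm_eq l1 c by apply: perm_arrange; rewrite sc.
have sl1 : size (map f l1) = psize p by rewrite size_map (perm_size pl1).
exists (map f l1 ++ l); split.
  apply: perm_trans (perm_map f pcr); rewrite map_cat.
  by apply: perm_cat pl; apply: perm_map.
rewrite take_size_cat // drop_size_cat // rl andbT.
apply/allP => x xp; have /andP[h1 h2] := okE _ xp.
have sl1' : size l1 = psize p by rewrite -sl1 size_map.
rewrite !(nth_map 0 x0 f) ?sl1' //.
set y := (let a := nth 0 l1 x.1 in let b := nth 0 l1 x.2 in
        if a < b then (a, b) else (b, a)).
have yp : y \in place l1 (pedges p) by apply/mapP; exists x.
suff : val y.
  by rewrite /val /y /=; case: ifP => _ /=; last rewrite e_sym.
have [/baseP //|nb] := boolP (look base y).
by apply: new; rewrite mem_filter nb.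
Qed.
End EmbedSound.

(** Each level of [solve] settles one more missing edge of [vars], so this fuel never runs out. *)
Definition search (n : nat) (base vars : seq edge) (w : edge -> nat) (b : nat)
    (alts : seq (seq part)) : bool :=
  all (all part_ok) alts &&
  solve w (size vars).+1 b
    (flatten [seq embed (table n base) (table n vars) ps (iota 0 n) | ps <- alts]).

Definition cycle_edges (m k : nat) : seq edge :=
  (m, m + k.-1) :: [seq (m + i, m + i.+1) | i <- iota 0 k.-1].

Definition cross (m k : nat) : seq edge :=
  [seq (i, m + j) | i <- iota 0 m, j <- iota 0 k].

(* Vertices [0 .. m - 1] form the leftover, the next [k] a cycle which receives
   more than twice the total weight, i.e. misses less than [(k - 2) * sumn w]. *)
Definition check (m k : nat) (base : seq edge) (w : seq nat) (alts : seq (seq part)) : bool :=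
  search (m + k) (base ++ cycle_edges m k) (cross m k) (fun x => nth 0 w x.1)
    ((k - 2) * sumn w).-1 alts.

(** * Patterns and the rearrangements verified by computation *)

Definition K3 := Part 3 [:: [:: 0; 1; 2]] [:: (0, 1); (1, 2); (2, 0)].
Definition C4 := Part 4 [:: [:: 0; 1; 2; 3]; [:: 0; 2; 1; 3]; [:: 0; 1; 3; 2]]
                      [:: (0, 1); (1, 2); (2, 3); (3, 0)].
Definition K2 := Part 2 [:: [:: 0; 1]] [:: (0, 1)].
Definition K2K2 := Part 4 [:: [:: 0; 1; 2; 3]; [:: 0; 2; 1; 3]; [:: 0; 3; 1; 2]]
                        [:: (0, 1); (2, 3)].
Definition P3 := Part 3 [:: [:: 0; 1; 2]; [:: 1; 0; 2]; [:: 0; 2; 1]] [:: (0, 1); (1, 2)].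
Definition P4 :=
  Part 4 [:: [:: 0; 1; 2; 3]; [:: 0; 1; 3; 2]; [:: 0; 2; 1; 3]; [:: 0; 2; 3; 1];
             [:: 0; 3; 1; 2]; [:: 0; 3; 2; 1]; [:: 1; 0; 2; 3]; [:: 1; 0; 3; 2];
             [:: 1; 2; 0; 3]; [:: 1; 3; 0; 2]; [:: 2; 0; 1; 3]; [:: 2; 1; 0; 3]]
         [:: (0, 1); (1, 2); (2, 3)].
Definition K13 := Part 4 [:: [:: 0; 1; 2; 3]; [:: 1; 0; 2; 3]; [:: 2; 0; 1; 3]; [:: 3; 0; 1; 2]]
                       [:: (0, 1); (0, 2); (0, 3)].
Definition paw :=
  Part 4 [:: [:: 0; 1; 2; 3]; [:: 0; 2; 1; 3]; [:: 1; 2; 0; 3];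
             [:: 0; 1; 3; 2]; [:: 0; 3; 1; 2]; [:: 1; 3; 0; 2];
             [:: 0; 2; 3; 1]; [:: 0; 3; 2; 1]; [:: 2; 3; 0; 1];
             [:: 1; 2; 3; 0]; [:: 1; 3; 2; 0]; [:: 2; 3; 1; 0]]
         [:: (0, 1); (1, 2); (2, 0); (2, 3)].

(** The dense piece is rebuilt with the same number of vertices, so the packing keeps its shape
    while the leftover gains one of the patterns [alts]. *)
Definition checks m base w alts :=
  check m 3 base w [seq K3 :: ps | ps <- alts] && check m 4 base w [seq C4 :: ps | ps <- alts].

Lemma check_E : checks 4 [::] [:: 1; 1; 1; 1] [:: [:: K2]].
Proof. by vm_compute. Qed.
Lemma check_K2 : checks 4 [:: (0, 1)] [:: 1; 1; 1; 1] [:: [:: K2K2]; [:: P3]].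
Proof. by vm_compute. Qed.
Lemma check_K2K2 : checks 4 [:: (0, 1); (2, 3)] [:: 1; 1; 1; 1] [:: [:: P3]].
Proof. by vm_compute. Qed.
Lemma check_P3 : checks 4 [:: (0, 1); (1, 2)] [:: 1; 1; 1; 1] [:: [:: P4]; [:: K13]; [:: K3]].
Proof. by vm_compute. Qed.
(** The three pairs of leaves are used once each, so a leaf has weight two and the centre weight
    zero. *)
Lemma check_K13 : checks 4 [:: (0, 1); (0, 2); (0, 3)] [:: 0; 2; 2; 2] [:: [:: P4]].
Proof. by vm_compute. Qed.
Lemma check_P4 : checks 4 [:: (0, 1); (1, 2); (2, 3)] [:: 1; 1; 1; 1] [:: [:: C4]; [:: K3]].
Proof. by vm_compute. Qed.
(** The vertex off the triangle is paired with each of the other three, hence its weight three. *)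
Lemma check_K3 : checks 4 [:: (0, 1); (1, 2); (0, 2)] [:: 1; 1; 1; 3] [:: [:: C4]; [:: paw]].
Proof. by vm_compute. Qed.
Lemma check_P4P4_K3 : check 8 3 [:: (0, 1); (1, 2); (2, 3); (4, 5); (5, 6); (6, 7)]
  (nseq 8 1) [:: [:: K3; C4]].
Proof. by vm_compute. Qed.
(* A vertex of the quadrilateral with three neighbours on one of the paths is
   adjacent to two vertices of that path at distance two: this gives, up to
   symmetry, the two last edges. *)
Lemma check_P4P4_C4 :
  check 8 4 [:: (0, 1); (1, 2); (2, 3); (4, 5); (5, 6); (6, 7); (0, 8); (2, 8)]
  (nseq 8 1) [:: [:: C4; C4]].
Proof. by vm_compute. Qed.
(** Positions 0 to 5 are [x], [y], [z], [a], [b], [c] of [good_two_tri], and 6 to 8 the dense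
    triangle. *)
Lemma check_K3s :
  check 6 3 [:: (0, 1); (1, 2); (0, 3); (0, 4); (0, 5); (2, 3); (2, 4); (3, 4); (4, 5); (3, 5)]
  [:: 1; 2; 1; 0; 0; 2] [:: [:: K3; K3; K3]].
Proof. by vm_compute. Qed.
Definition P4P4_base := [:: (0, 1); (1, 2); (2, 3); (4, 5); (5, 6); (6, 7)].
Definition P4P4_vars : seq edge :=
  [:: (0, 2); (0, 3); (0, 4); (0, 5); (0, 6); (0, 7); (1, 3); (1, 4); (1, 5);
      (1, 6); (1, 7); (2, 4); (2, 5); (2, 6); (2, 7); (3, 4); (3, 5); (3, 6);
      (3, 7); (4, 6); (4, 7); (5, 7)].
(* A graph on two disjoint [P4]'s with at least 16 edges contains [C4]. *)
Lemma search_P4P4 : search 8 P4P4_base P4P4_vars (fun=> 1) 12 [:: [:: C4]].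
Proof. by vm_compute. Qed.

(** * Packings and the counting argument *)

Section Packing.
Variables (T : finType) (e : rel T).

Definition edges_to (X s : seq T) : nat := \sum_(x <- X) count (e x) s.

Lemma edges_to_cons x X s : edges_to (x :: X) s = count (e x) s + edges_to X s.
Proof. by rewrite /edges_to big_cons. Qed.

Lemma edges_to_nil s : edges_to [::] s = 0.
Proof. by rewrite /edges_to big_nil. Qed.

Lemma edges_to_catl X Y s : edges_to (X ++ Y) s = edges_to X s + edges_to Y s.
Proof. by rewrite /edges_to big_cat. Qed.

Lemma edges_to_cat X s t : edges_to X (s ++ t) = edges_to X s + edges_to X t.
Proof. by rewrite /edges_to -big_split; apply: eq_bigr => x _; rewrite count_cat. Qed.

Lemma edges_to_perm X Y s t :
  perm_eq X Y -> perm_eq s t -> edges_to X s = edges_to Y t.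
Proof.
move=> pX /permP pst; rewrite /edges_to (perm_big _ pX).
by apply: eq_bigr => x _; apply: pst.
Qed.

Lemma edges_to_flatten X ss : edges_to X (flatten ss) = \sum_(s <- ss) edges_to X s.
Proof.
elim: ss => [|s ss IH] /=; last by rewrite edges_to_cat IH big_cons.
by rewrite big_nil /edges_to big1.
Qed.

Definition piece (k : nat) (s : seq T) : bool := (size s == k) && cycle e s.

(** A single permutation of [enum T] expresses that the pieces and [W] are disjoint, have no
    repeated vertex and exhaust the graph. *)
Definition packing (i j : nat) (W : seq T) : Prop :=
  exists tl ql, [/\ size tl = i, size ql = j, all (piece 3) tl, all (piece 4) ql
    & perm_eq (flatten tl ++ flatten ql ++ W) (enum T)].

Lemma packing_perm i j W W' : perm_eq W W' -> packing i j W -> packing i j W'.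
Proof.
move=> pW [tl [ql [sz1 sz2 a1 a2 p]]]; exists tl, ql; split=> //.
by rewrite perm_sym in pW; apply: perm_trans p; do 2!apply: perm_cat => //.
Qed.

Lemma packing_tri i j t W : piece 3 t -> packing i j (t ++ W) -> packing i.+1 j W.
Proof.
move=> pt [tl [ql [<- sz2 a1 a2 p]]]; exists (t :: tl), ql; split=> //=; first by rewrite pt.
apply: perm_trans p; apply/permP => x; rewrite !count_cat; lia.
Qed.

Lemma packing_quad i j q W : piece 4 q -> packing i j (q ++ W) -> packing i j.+1 W.
Proof.
move=> pt [tl [ql [sz1 <- a1 a2 p]]]; exists tl, (q :: ql); split=> //=; first by rewrite pt.
apply: perm_trans p; apply/permP => x; rewrite /= !count_cat; lia.
Qed.

Lemma packing_uniq i j W : packing i j W -> uniq W.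
Proof.
move=> [tl [ql [_ _ _ _ /perm_uniq]]]; rewrite enum_uniq !cat_uniq.
by case/and3P=> _ _ /and3P[].
Qed.

Lemma exists_heavy (X : seq T) (c : nat) (ss : seq (seq T)) :
  size ss * c < \sum_(s <- ss) edges_to X s -> exists2 s, s \in ss & c < edges_to X s.
Proof.
elim: ss => [|s ss IH] /=; first by rewrite big_nil.
rewrite big_cons; have [h|h] := ltnP c (edges_to X s); first by exists s; rewrite ?mem_head.
rewrite mulSn => h2; have [|s' s's h'] := IH; first by lia.
by exists s'; rewrite // in_cons s's orbT.
Qed.

(** With [N] a quarter of the bound on degree sums, every nonadjacent pair is heavy, and so is every
    concatenation of such pairs. *)
Definition heavy (N : nat) (X : seq T) := 2 * size X * N <= edges_to X (enum T).

Lemma heavy_perm N X Y : perm_eq X Y -> heavy N X -> heavy N Y.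
Proof. by move=> p; rewrite /heavy (edges_to_perm p (perm_refl _)) (perm_size p). Qed.

Lemma heavy_cat N X Y : heavy N X -> heavy N Y -> heavy N (X ++ Y).
Proof. by rewrite /heavy edges_to_catl size_cat mulnDr mulnDl; exact: leq_add. Qed.

(** Here [k] is the number of pieces that [W] stands for. If every piece received at most
    [2 * size X] edges, the total would fall short of [2 * size X * N]. *)
Lemma pigeonhole N X W i j k :
  packing i j W -> heavy N X -> i + j + k = N -> edges_to X W < 2 * size X * k ->
  (exists i' t, [/\ i = i'.+1, piece 3 t, packing i' j (t ++ W) & 2 * size X < edges_to X t])
  \/
  (exists j' q, [/\ j = j'.+1, piece 4 q, packing i j' (q ++ W) & 2 * size X < edges_to X q]).
Proof.
move=> [tl [ql [sz1 sz2 a1 a2 p]]]; rewrite /heavy -(edges_to_perm (perm_refl X) p).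
rewrite !edges_to_cat !edges_to_flatten => hX hN hW; set c := 2 * size X in hX hW *.
have [h1|h1] := ltnP (size tl * c) (\sum_(s <- tl) edges_to X s).
  have [t tin ht] := exists_heavy h1; left.
  exists (size tl).-1, t; split=> //.
  - by case: (tl) tin sz1.
  - exact: (allP a1).
  - exists (rem t tl), ql; split=> //; first by rewrite size_rem.
      by apply/allP => s /mem_rem /(allP a1).
    apply: perm_trans p; apply/permP => x; rewrite !count_cat.
    have /permP /(_ x) := perm_flatten (perm_to_rem tin); rewrite /= count_cat; lia.
have [h2|h2] := ltnP (size ql * c) (\sum_(s <- ql) edges_to X s).
  have [q qin hq] := exists_heavy h2; right.
  exists (size ql).-1, q; split=> //.
  - by case: (ql) qin sz2.
  - exact: (allP a2).
  - exists tl, (rem q ql); split=> //; first by rewrite size_rem.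
      by apply/allP => s /mem_rem /(allP a2).
    apply: perm_trans p; apply/permP => x; rewrite !count_cat.
    have /permP /(_ x) := perm_flatten (perm_to_rem qin); rewrite /= count_cat; lia.
by exfalso; move: hX; rewrite -hN sz1 sz2 in h1 h2 *; rewrite !mulnDr [c * i]mulnC [c * j]mulnC; lia.
Qed.

(** Multiplicities let a vertex occur in several nonadjacent pairs. *)
Definition weigh (w : seq nat) (W : seq T) : seq T :=
  flatten [seq nseq p.1 p.2 | p <- zip w W].

Lemma size_weigh w W : size w = size W -> size (weigh w W) = sumn w.
Proof.
by elim: w W => [|a w IH] [|x W] //= [/IH h]; rewrite size_cat size_nseq h.
Qed.

Lemma edges_to_weigh x0 w W s : size w = size W ->
  edges_to (weigh w W) s
  = \sum_(i <- iota 0 (size W)) nth 0 w i * count (e (nth x0 W i)) s.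
Proof.
elim: w W => [|a w IH] [|x W] //= sz; first by rewrite big_nil edges_to_nil.
rewrite edges_to_catl IH; last by case: sz.
rewrite big_cons -[1]addn0 iotaDl big_map; congr (_ + _).
by elim: a {sz} => [|a IHa]; rewrite ?edges_to_nil // mulSn edges_to_cons IHa.
Qed.

Hypothesis e_sym : symmetric e.
Variable x0 : T.

Definition adj_at (vs : seq T) (x : edge) := e (nth x0 vs x.1) (nth x0 vs x.2).

Lemma search_sound n base vars w b alts vs :
  size vs = n -> uniq vars -> all (adj_at vs) base ->
  missing w (adj_at vs) vars <= b -> search n base vars w b alts ->
  exists l, perm_eq l vs /\ has (fun ps => realize x0 e ps l) alts.
Proof.
move=> sz uv /allP hb hm /andP[okA]; apply: (@solve_sound _ (adj_at vs)) uv _ hm.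
elim: alts okA => [_ p //|ps alts IH] /= /andP[okps /IH{}IH] p.
rewrite mem_cat => /orP[|/IH [sub hp]]; last first.
  by split=> // /hp [l [pl hl]]; exists l; rewrite pl hl orbT.
case/(@embed_sound _ x0 e (nth x0 vs) e_sym) => // [x /lookP|sub hp]; first exact: hb.
split=> [x /sub /= /lookP //|/hp [l [pl rl]]]; exists l; rewrite rl.
by move: pl; rewrite -sz map_nth_iota0 // take_size.
Qed.

Lemma count_sum (a : pred T) s : count a s = \sum_(j <- iota 0 (size s)) a (nth x0 s j).
Proof.
elim: s => [|x s IH] /=; first by rewrite big_nil.
by rewrite big_cons -[1]addn0 iotaDl big_map IH.
Qed.

Lemma sumn_nth w : sumn w = \sum_(i <- iota 0 (size w)) nth 0 w i.
Proof.
elim: w => [|a w IH] /=; first by rewrite big_nil.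
by rewrite big_cons -[1]addn0 iotaDl big_map IH.
Qed.

(** Present and missing edges between [W] and [p] weigh [k * sumn w] together. More than
    [2 * sumn w] present thus keeps the missing weight within the budget of [check]. *)
Lemma exchange k base w alts W p :
  2 < k < 5 -> size w = size W -> piece k p -> all (adj_at (W ++ p)) base ->
  2 * sumn w < edges_to (weigh w W) p -> check (size W) k base w alts ->
  exists l, perm_eq l (W ++ p) /\ has (fun ps => realize x0 e ps l) alts.
Proof.
move=> hk szw /andP[/eqP szp cp] hb hF; apply: search_sound.
- by rewrite size_cat szp.
- apply: allpairs_uniq; rewrite ?iota_uniq // => -[i j] [i' j'] _ _ /= [-> /eqP].
  by rewrite eqn_add2l => /eqP ->.
- rewrite all_cat hb /=.
  have nthW i : nth x0 (W ++ p) (size W + i) = nth x0 p i by rewrite nth_cat ltnNge leq_addr addKn.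
  have nthW0 : nth x0 (W ++ p) (size W) = nth x0 p 0 by rewrite -[size W]addn0 nthW.
  rewrite -szp in hk *; case: p hk cp nthW nthW0 {hb hF szp} => [|a [|b [|c [|d [|? ?]]]]] //=.
    move=> _ + nthW nthW0; rewrite /adj_at /= ?addn0 !nthW nthW0 /= andbT.
    by rewrite [e a c]e_sym => /and3P[-> -> ->].
  move=> _ + nthW nthW0; rewrite /adj_at /= ?addn0 !nthW nthW0 /= andbT.
  by rewrite [e a d]e_sym => /and4P[-> -> -> ->].
set mis := missing _ _ _.
have : edges_to (weigh w W) p + mis = k * sumn w.
  rewrite (edges_to_weigh x0) // /mis /missing /cross big_allpairs_dep -big_split.
  rewrite sumn_nth big_distrr /= szw.
  rewrite !big_seq; apply: eq_bigr => i; rewrite mem_iota => /andP[_ hi].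
  rewrite count_sum szp big_distrr /= -big_split /=.
  transitivity (\sum_(j <- iota 0 k) nth 0 w i); last first.
    by rewrite big_const_seq count_predT size_iota iter_addn_0 mulnC.
  apply: eq_bigr => j _; rewrite /adj_at /= !nth_cat hi ltnNge leq_addr addKn /=.
  by case: (e _ _); rewrite ?muln0 ?muln1 ?addn0.
rewrite mulnBl; lia.
Qed.

Lemma step N i j k W w base alts :
  packing i j W -> size w = size W -> (forall p, all (adj_at (W ++ p)) base) ->
  heavy N (weigh w W) -> i + j + k = N -> edges_to (weigh w W) W < 2 * sumn w * k ->
  checks (size W) base w alts ->
  exists l, [/\ packing i j l, size l = size W & has (fun ps => realize x0 e ps l) alts].
Proof.
move=> hp szw hb hX hN hF /andP[ch3 ch4].
rewrite -(size_weigh szw) in hF.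
have hasK (P : part) l : has (fun ps => realize x0 e ps l) [seq P :: ps | ps <- alts] ->
    all (fun x => e (nth x0 (take (psize P) l) x.1) (nth x0 (take (psize P) l) x.2)) (pedges P)
    /\ has (fun ps => realize x0 e ps (drop (psize P) l)) alts.
  by elim: (alts) => //= ps alts' IH /orP[/andP[-> ->] //|/IH [-> ->]]; rewrite orbT.
case: (pigeonhole hp hX hN hF) => [[i' [t [-> pt ht hFt]]]|[j' [q [-> pq hq hFq]]]].
  rewrite (size_weigh szw) in hFt.
  have [l [pl /hasK [hK hl]]] := exchange (isT : 2 < 3 < 5) szw pt (hb t) hFt ch3.
  have szl := perm_size pl; rewrite size_cat (eqP (proj1 (andP pt))) addn3 in szl.
  move: pl szl hK hl; case: l => [|a [|b [|c l]]] //= pl [szl].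
  rewrite drop0 => hK hl; exists l; split=> //.
  apply: (@packing_tri _ _ [:: a; b; c]); first by rewrite /piece /= in hK *.
  by apply: packing_perm ht; rewrite perm_sym (permPl pl) perm_catC.
rewrite (size_weigh szw) in hFq.
have [l [pl /hasK [hK hl]]] := exchange (isT : 2 < 4 < 5) szw pq (hb q) hFq ch4.
have szl := perm_size pl; rewrite size_cat (eqP (proj1 (andP pq))) addn4 in szl.
move: pl szl hK hl; case: l => [|a [|b [|c [|d l]]]] //= pl [szl].
rewrite drop0 => hK hl; exists l; split=> //.
apply: (@packing_quad _ _ [:: a; b; c; d]); first by rewrite /piece /= in hK *.
by apply: packing_perm hq; rewrite perm_sym (permPl pl) perm_catC.
Qed.
End Packing.

(* [lia] alone would split on every boolean of the context. *)
Ltac count_lia :=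
  change (nat_of_bool true) with 1;
  repeat match goal with |- context [nat_of_bool ?b] => generalize (nat_of_bool b) end;
  repeat match goal with H : _ |- _ => clear H end;
  lia.
Ltac perm_lia := apply/permP => ? /=; count_lia.

(** * Rearranging the leftover *)

Section Chain.
Variables (T : finType) (e : rel T) (x0 : T) (r s : nat).
Hypothesis e_sym : symmetric e.
Hypothesis e_irr : irreflexive e.
Hypothesis sigma : forall x y, x != y -> ~~ e x y -> 4 * (r + s.+1) <= deg e x + deg e y.
Local Notation N := (r + s.+1).
Local Notation packing := (packing e).
Local Notation heavy := (heavy e).
Local Notation edges_to := (edges_to e).

Lemma deg_count x : deg e x = count (e x) (enum T).
Proof. by rewrite /deg cardsE cardE -size_filter enumT. Qed.

Lemma heavy_pair x y : x != y -> ~~ e x y -> heavy N [:: x; y].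
Proof.
move=> nxy nexy; have := sigma nxy nexy; rewrite !deg_count.
by rewrite /(heavy _ _) !edges_to_cons edges_to_nil /=; lia.
Qed.

(** [C4] and [paw] are the two graphs with four vertices and four edges, so this is what is wanted
    of [D]. *)
Definition good := exists a b c d, packing r s [:: a; b; c; d] /\
  has (fun ps => realize x0 e ps [:: a; b; c; d]) [:: [:: C4]; [:: paw]].

Lemma packing_neq i j a b W W' : packing i j W -> perm_eq W [:: a, b & W'] -> a != b.
Proof.
move=> /packing_uniq + p; rewrite (perm_uniq p) /= in_cons negb_or.
by case/andP=> /andP[].
Qed.

Lemma step4 w base alts a b c d :
  packing r s [:: a; b; c; d] -> size w = 4 ->
  (forall p, all (adj_at e x0 ([:: a; b; c; d] ++ p)) base) ->
  heavy N (weigh w [:: a; b; c; d]) ->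
  edges_to (weigh w [:: a; b; c; d]) [:: a; b; c; d] < 2 * sumn w ->
  checks 4 base w alts ->
  exists a' b' c' d', packing r s [:: a'; b'; c'; d'] /\
    has (fun ps => realize x0 e ps [:: a'; b'; c'; d']) alts.
Proof.
move=> hp szw hb hX hF hc; rewrite -[2 * sumn w]muln1 in hF.
have [|l [pl szl hl]] := step e_sym hp szw hb hX _ hF hc; first by rewrite addn1 addnS.
case: l pl szl hl => [|a' [|b' [|c' [|d' []]]]] // pl _ hl.
by exists a', b', c', d'.
Qed.

Lemma packing4_neq a b c d : packing r s [:: a; b; c; d] ->
  [/\ a != b, a != c, a != d & [/\ b != c, b != d & c != d]].
Proof.
move=> /packing_uniq; rewrite /= !inE !negb_or.
by case/and4P=> /and3P[-> -> ->] /andP[-> ->] -> _.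
Qed.

Ltac count_edges a b c d :=
  rewrite /weigh /= !edges_to_cons edges_to_nil /= !e_irr
    ?(e_sym b a) ?(e_sym c a) ?(e_sym d a) ?(e_sym c b) ?(e_sym d b) ?(e_sym d c).

(** An edge from [d] to the triangle gives a [paw]. Otherwise [d] is paired with each of [a], [b],
    [c]; these pairs send only six edges into the leftover, below the required 12. *)
Lemma good_K3 a b c d : packing r s [:: a; b; c; d] -> e a b -> e b c -> e a c -> good.
Proof.
move=> hp ab bc ac.
have pawP x y z : perm_eq [:: x; y; z] [:: a; b; c] -> e x y -> e y z -> e z x -> e z d -> good.
  move=> p xy yz zx zd; exists x, y, z, d; split; last by rewrite /= xy yz zx zd !orbT.
  by apply: packing_perm hp; apply/permP => f; have /permP/(_ f) /= := p; count_lia.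
have [ad|ad] := boolP (e a d); first by apply: (pawP b c a) => //; [perm_lia|rewrite e_sym].
have [bd|bd] := boolP (e b d); first by apply: (pawP c a b) => //; [perm_lia|rewrite e_sym].
have [cd|cd] := boolP (e c d); first by apply: (pawP a b c) => //; rewrite e_sym.
have [_ _ nad [_ nbd ncd]] := packing4_neq hp.
apply: (step4 hp _ _ _ _ check_K3) => //.
- by move=> p; rewrite /= /adj_at /= ab bc ac.
- apply: heavy_perm (heavy_cat (heavy_cat (heavy_pair nad ad) (heavy_pair nbd bd))
    (heavy_pair ncd cd)).
  perm_lia.
- by count_edges a b c d; rewrite ab ac bc (negPf ad) (negPf bd) (negPf cd).
Qed.

(** A chord gives a triangle or closes a [C4]. Otherwise [a], [c] and [b], [d] are nonadjacent
    pairs; the same two pairs serve for [P3], [K2K2], [K2] and the empty leftover. *)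
Lemma good_P4 a b c d : packing r s [:: a; b; c; d] -> e a b -> e b c -> e c d -> good.
Proof.
move=> hp ab bc cd.
have [ac|ac] := boolP (e a c); first exact: (good_K3 hp).
have [bd|bd] := boolP (e b d).
  by apply: (@good_K3 b c d a) => //; apply: packing_perm hp; perm_lia.
have [ad|ad] := boolP (e a d).
  by exists a, b, c, d; split=> //; rewrite /= ab bc cd e_sym ad.
have [_ nac _ [_ nbd _]] := packing4_neq hp.
have [|||a' [b' [c' [d' [pl]]]]] := step4 hp (w := [:: 1; 1; 1; 1]) erefl _ _ _ check_P4.
- by move=> p; rewrite /= /adj_at /= ab bc cd.
- by apply: heavy_perm (heavy_cat (heavy_pair nac ac) (heavy_pair nbd bd)); perm_lia.
- by count_edges a b c d; rewrite ab bc cd (negPf ad) (negPf bd) (negPf ac).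
rewrite /= ?andbT ?orbF => /orP[h|/and3P[ab' bc' ca']].
  by exists a', b', c', d'; split=> //; rewrite /= !andbT h.
by apply: (good_K3 pl) => //; rewrite e_sym.
Qed.

Lemma good_K13 a b c d : packing r s [:: a; b; c; d] -> e a b -> e a c -> e a d -> good.
Proof.
move=> hp ab ac ad.
have [bc|bc] := boolP (e b c); first exact: (good_K3 hp).
have [bd|bd] := boolP (e b d).
  by apply: (@good_K3 a b d c) => //; apply: packing_perm hp; perm_lia.
have [cd|cd] := boolP (e c d).
  by apply: (@good_K3 a c d b) => //; apply: packing_perm hp; perm_lia.
have [_ _ _ [nbc nbd ncd]] := packing4_neq hp.
have [|||a' [b' [c' [d' [pl]]]]] := step4 hp (w := [:: 0; 2; 2; 2]) erefl _ _ _ check_K13.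
- by move=> p; rewrite /= /adj_at /= ab ac ad.
- apply: heavy_perm (heavy_cat (heavy_cat (heavy_pair nbc bc) (heavy_pair nbd bd))
    (heavy_pair ncd cd)).
  perm_lia.
- by count_edges a b c d; rewrite ab ac ad (negPf bc) (negPf bd) (negPf cd).
by rewrite /= ?andbT ?orbF => /and3P[ab' bc' cd']; apply: (good_P4 pl).
Qed.

Lemma good_P3 a b c d : packing r s [:: a; b; c; d] -> e a b -> e b c -> good.
Proof.
move=> hp ab bc.
have [ac|ac] := boolP (e a c); first exact: (good_K3 hp).
have [ad|ad] := boolP (e a d).
  by apply: (@good_P4 c b a d) => //; rewrite 1?e_sym //; apply: packing_perm hp; perm_lia.
have [bd|bd] := boolP (e b d).
  by apply: (@good_K13 b a c d) => //; rewrite 1?e_sym //; apply: packing_perm hp; perm_lia.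
have [cd|cd] := boolP (e c d); first exact: (good_P4 hp).
have [_ nac _ [_ nbd _]] := packing4_neq hp.
have [|||a' [b' [c' [d' [pl]]]]] := step4 hp (w := [:: 1; 1; 1; 1]) erefl _ _ _ check_P3.
- by move=> p; rewrite /= /adj_at /= ab bc.
- by apply: heavy_perm (heavy_cat (heavy_pair nac ac) (heavy_pair nbd bd)); perm_lia.
- by count_edges a b c d; rewrite ab bc (negPf ac) (negPf ad) (negPf bd) (negPf cd).
rewrite /= ?andbT ?orbF => /or3P[] /and3P[h1 h2 h3].
- exact: (good_P4 pl).
- exact: (good_K13 pl).
- by apply: (good_K3 pl) => //; rewrite e_sym.
Qed.

Lemma good_K2K2 a b c d : packing r s [:: a; b; c; d] -> e a b -> e c d -> good.
Proof.
move=> hp ab cd.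
have [ac|ac] := boolP (e a c).
  by apply: (@good_P3 b a c d) => //; rewrite 1?e_sym //; apply: packing_perm hp; perm_lia.
have [ad|ad] := boolP (e a d).
  by apply: (@good_P3 b a d c) => //; rewrite 1?e_sym //; apply: packing_perm hp; perm_lia.
have [bc|bc] := boolP (e b c); first exact: (good_P3 hp).
have [bd|bd] := boolP (e b d).
  by apply: (@good_P3 a b d c) => //; apply: packing_perm hp; perm_lia.
have [_ nac _ [_ nbd _]] := packing4_neq hp.
have [|||a' [b' [c' [d' [pl]]]]] := step4 hp (w := [:: 1; 1; 1; 1]) erefl _ _ _ check_K2K2.
- by move=> p; rewrite /= /adj_at /= ab cd.
- by apply: heavy_perm (heavy_cat (heavy_pair nac ac) (heavy_pair nbd bd)); perm_lia.
- by count_edges a b c d; rewrite ab cd (negPf ac) (negPf ad) (negPf bc) (negPf bd).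
by rewrite /= ?andbT ?orbF => /andP[h1 h2]; apply: (good_P3 pl).
Qed.

Lemma good_K2 a b c d : packing r s [:: a; b; c; d] -> e a b -> good.
Proof.
move=> hp ab.
have [ac|ac] := boolP (e a c).
  by apply: (@good_P3 b a c d) => //; rewrite 1?e_sym //; apply: packing_perm hp; perm_lia.
have [ad|ad] := boolP (e a d).
  by apply: (@good_P3 b a d c) => //; rewrite 1?e_sym //; apply: packing_perm hp; perm_lia.
have [bc|bc] := boolP (e b c); first exact: (good_P3 hp).
have [bd|bd] := boolP (e b d).
  by apply: (@good_P3 a b d c) => //; apply: packing_perm hp; perm_lia.
have [cd|cd] := boolP (e c d); first exact: (good_K2K2 hp).
have [_ nac _ [_ nbd _]] := packing4_neq hp.
have [|||a' [b' [c' [d' [pl]]]]] := step4 hp (w := [:: 1; 1; 1; 1]) erefl _ _ _ check_K2.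
- by move=> p; rewrite /= /adj_at /= ab.
- by apply: heavy_perm (heavy_cat (heavy_pair nac ac) (heavy_pair nbd bd)); perm_lia.
- count_edges a b c d.
  by rewrite ab (negPf cd) (negPf ac) (negPf ad) (negPf bc) (negPf bd).
rewrite /= ?andbT ?orbF => /orP[] /andP[h1 h2]; first exact: (good_K2K2 pl).
exact: (good_P3 pl).
Qed.

Lemma good_any a b c d : packing r s [:: a; b; c; d] -> good.
Proof.
move=> hp.
have [ab|ab] := boolP (e a b); first exact: (good_K2 hp).
have [ac|ac] := boolP (e a c).
  by apply: (@good_K2 a c b d) => //; apply: packing_perm hp; perm_lia.
have [ad|ad] := boolP (e a d).
  by apply: (@good_K2 a d b c) => //; apply: packing_perm hp; perm_lia.
have [bc|bc] := boolP (e b c).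
  by apply: (@good_K2 b c a d) => //; apply: packing_perm hp; perm_lia.
have [bd|bd] := boolP (e b d).
  by apply: (@good_K2 b d a c) => //; apply: packing_perm hp; perm_lia.
have [cd|cd] := boolP (e c d).
  by apply: (@good_K2 c d a b) => //; apply: packing_perm hp; perm_lia.
have [_ nac _ [_ nbd _]] := packing4_neq hp.
have [|||a' [b' [c' [d' [pl]]]]] := step4 hp (w := [:: 1; 1; 1; 1]) erefl _ _ _ check_E.
- by [].
- by apply: heavy_perm (heavy_cat (heavy_pair nac ac) (heavy_pair nbd bd)); perm_lia.
- count_edges a b c d.
  by rewrite (negPf ab) (negPf cd) (negPf ac) (negPf ad) (negPf bc) (negPf bd).
by rewrite /= ?andbT ?orbF; apply: (good_K2 pl).
Qed.

Lemma good_size4 W : size W = 4 -> packing r s W -> good.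
Proof. by case: W => [|a [|b [|c [|d []]]]] // _; exact: good_any. Qed.

(** One of the [s.+1] quadrilaterals plays the role of [D]. *)
Lemma good_full : packing r s.+1 [::] -> good.
Proof.
move=> [tl [[|q ql] [szt szq //= at_ /andP[/andP[/eqP szq4 cq] aq] p]]].
case: q szq4 cq p szq => [|a [|b [|c [|d []]]]] // _ cq p szq.
exists a, b, c, d; split; last by move: cq; rewrite /= => ->.
exists tl, ql; split=> //; first by case: szq.
apply: perm_trans p; apply/permP => f; rewrite /= cats0 !count_cat /=; count_lia.
Qed.

(** * Repairing a broken triangle *)

(** Three neighbours on a 4-cycle include two consecutive ones. With [v] they form the lacking
    triangle, and the other two vertices join [u] and [w] as leftover. *)
Lemma good_quad_tri i u v w q : i.+1 = r -> piece e 4 q ->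
  packing i s (q ++ [:: v; u; w]) -> 2 < count (e v) q -> good.
Proof.
move=> ir /andP[/eqP szq cq] hp.
case: q szq cq hp => [|a [|b [|c [|d []]]]] // _ /= /and5P[ab bc cd da _] hp hv.
have triP x y z t : perm_eq [:: x; y; z; t] [:: a; b; c; d] -> e x y -> e v x -> e v y -> good.
  move=> p xy vx vy; apply: (@good_any u w z t); rewrite -ir.
  apply: (@packing_tri _ _ _ _ [:: v; x; y]); first by rewrite /piece /= vx xy e_sym vy.
  by apply: packing_perm hp; apply/permP => f; have /permP/(_ f) /= := p; count_lia.
(* Two opposite edges of the cycle suffice: with at most one neighbour on each, [v] would have at
   most two. *)
have [/andP[va vb]|] := boolP (e v a && e v b); first exact: (triP a b c d).
have [/andP[vc vd] _|] := boolP (e v c && e v d).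
  by apply: (triP c d a b) => //; perm_lia.
by move: hv; case: (e v a); case: (e v b); case: (e v c); case: (e v d).
Qed.

(** Only the edge from [z] to [c] is left open between the ends of the path and the triangle. A
    neighbour of [y] among [a], [b], [c] yields two triangles at once; otherwise [y], [c] is a
    nonadjacent pair besides [x], [z]. *)
Lemma good_two_tri i x y z a b c : i.+2 = r -> packing i s.+1 [:: x; y; z; a; b; c] ->
  e x y -> e y z -> ~~ e x z -> e a b -> e b c -> e a c ->
  e x a -> e x b -> e x c -> e z a -> e z b -> good.
Proof.
move=> ir hp xy yz xz ab bc ac xa xb xc za zb.
have twoP u1 u2 u3 v1 v2 v3 : perm_eq [:: u1; u2; u3; v1; v2; v3] [:: x; y; z; a; b; c] ->
    e u1 u2 -> e u2 u3 -> e u3 u1 -> e v1 v2 -> e v2 v3 -> e v3 v1 -> good.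
  move=> p u12 u23 u31 v12 v23 v31; apply: good_full; rewrite -ir.
  apply: (@packing_tri _ _ _ _ [:: u1; u2; u3]); first by rewrite /piece /= u12 u23 u31.
  apply: (@packing_tri _ _ _ _ [:: v1; v2; v3]); first by rewrite /piece /= v12 v23 v31.
  by apply: packing_perm hp; apply/permP => f; have /permP/(_ f) /= := p; count_lia.
have [ya|ya] := boolP (e y a).
  by apply: (twoP y z a x b c) => //; rewrite 1?e_sym //; perm_lia.
have [yb|yb] := boolP (e y b).
  by apply: (twoP y z b x a c) => //; rewrite 1?e_sym //; perm_lia.
have [yc|yc] := boolP (e y c).
  by apply: (twoP x y c z a b) => //; rewrite 1?e_sym //; perm_lia.
have nxz : x != z by apply: (packing_neq (W' := [:: y; a; b; c]) hp); perm_lia.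
have nyc : y != c by apply: (packing_neq (W' := [:: x; z; a; b]) hp); perm_lia.
(* The pair [x], [z] is taken once and the pair [y], [c] twice. *)
set w := [:: 1; 2; 1; 0; 0; 2].
have hX : heavy N (weigh w [:: x; y; z; a; b; c]).
  apply: heavy_perm (heavy_cat (heavy_cat (heavy_pair nxz xz) (heavy_pair nyc yc))
    (heavy_pair nyc yc)); perm_lia.
(* At most 20 edges stay inside, against 24; the last factor 2 stands for the two pieces short of
   [N]. *)
have hF : edges_to (weigh w [:: x; y; z; a; b; c]) [:: x; y; z; a; b; c]
    < 2 * size (weigh w [:: x; y; z; a; b; c]) * 2.
  rewrite /weigh /= !edges_to_cons edges_to_nil /= !e_irr (e_sym y x) (e_sym z x) (e_sym z y).
  rewrite (e_sym c x) (e_sym c y) (e_sym c z) (e_sym c a) (e_sym c b).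
  rewrite xy yz (negPf xz) xa xb xc (negPf ya) (negPf yb) (negPf yc) za zb ac bc.
  by case: (e z c).
have hN : i + s.+1 + 2 = N by move: ir; clear; lia.
case: (pigeonhole hp hX hN hF) => [[i' [t [ii' pt ht hFt]]]|[j' [q [jj' pq hq hFq]]]].
  have [||l [pl]] := exchange e_sym (x0 := x0) (isT : 2 < 3 < 5) (erefl : size w = size [:: x; y; z; a; b; c]) pt _ _ check_K3s.
  - by rewrite /= /adj_at /= xy yz xa xb xc za zb ab bc ac.
  - exact: hFt.
  have szl := perm_size pl; rewrite size_cat (eqP (proj1 (andP pt))) in szl.
  case: l pl szl => [|l1 [|l2 [|l3 [|l4 [|l5 [|l6 [|l7 [|l8 [|l9 []]]]]]]]]] //= pl _.
  rewrite !andbT orbF => /and3P[/and3P[h12 h23 h31] /and3P[h45 h56 h64] /and3P[h78 h89 h97]].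
  apply: good_full; rewrite -ir ii'.
  apply: (@packing_tri _ _ _ _ [:: l1; l2; l3]); first by rewrite /piece /= h12 h23 h31.
  apply: (@packing_tri _ _ _ _ [:: l4; l5; l6]); first by rewrite /piece /= h45 h56 h64.
  apply: (@packing_tri _ _ _ _ [:: l7; l8; l9]); first by rewrite /piece /= h78 h89 h97.
  apply: packing_perm ht; apply/permP => f; have /permP/(_ f) /= := pl.
  rewrite !count_cat /=; count_lia.
case: jj' hq => <- hq.
(* More than 12 weighted edges force three neighbours in [q] for one of [x], [y], [z], [c]. For [c],
   the triangle kept is [z], [a], [b] instead of [a], [b], [c]. *)
have abcP v u1 u2 : perm_eq [:: v; u1; u2] [:: x; y; z] -> 2 < count (e v) q -> good.
  move=> p; apply: (@good_quad_tri i.+1 u1 v u2 q) => //.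
  apply: (@packing_tri _ _ _ _ [:: a; b; c]); first by rewrite /piece /= ab bc e_sym ac.
  apply: packing_perm hq; apply/permP => f; have /permP/(_ f) /= := p.
  rewrite /= !count_cat /=; count_lia.
have [hx|hx] := ltnP 2 (count (e x) q); first exact: (abcP x y z).
have [hy|hy] := ltnP 2 (count (e y) q); first by apply: (abcP y x z) => //; perm_lia.
have [hz|hz] := ltnP 2 (count (e z) q); first by apply: (abcP z x y) => //; perm_lia.
have [hc|hc] := ltnP 2 (count (e c) q); last first.
  by exfalso; move: hFq hx hy hz hc; rewrite /weigh /= !edges_to_cons edges_to_nil; clear; lia.
apply: (@good_quad_tri i.+1 x c y q) => //.
apply: (@packing_tri _ _ _ _ [:: z; a; b]); first by rewrite /piece /= za ab e_sym zb.
by apply: packing_perm hq; apply/permP => f; rewrite /= !count_cat /=; count_lia.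
Qed.

(** Some piece receives at least five edges from the nonadjacent ends [x], [z]: five of the six
    possible ones if it is a triangle, and three from one end if it is a quadrilateral. *)
Lemma good_broken_tri i x y z : i.+1 = r -> packing i s.+1 [:: x; y; z] ->
  e x y -> e y z -> ~~ e x z -> good.
Proof.
move=> ir hp xy yz xz.
have nxz : x != z by apply: (packing_neq (W' := [:: y]) hp); perm_lia.
have hF : edges_to [:: x; z] [:: x; y; z] < 2 * size [:: x; z] * 1.
  rewrite !edges_to_cons edges_to_nil /= !e_irr (e_sym z x) (e_sym z y).
  by rewrite xy yz (negPf xz).
have hN : i + s.+1 + 1 = N by move: ir; clear; lia.
case: (pigeonhole hp (heavy_pair nxz xz) hN hF) => [[i' [t [ii' pt ht hFt]]]|[j' [q [jj' pq hq hFq]]]].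
  move: pt ht hFt; case: t => [|a [|b [|c []]]] // /andP[_ /= /and4P[ab bc ca _]] ht.
  rewrite ii' in ir; rewrite !edges_to_cons edges_to_nil /=.
  have tP u1 u3 v1 v2 v3 : perm_eq [:: u1; u3] [:: x; z] -> perm_eq [:: v1; v2; v3] [:: a; b; c] ->
     e u1 y -> e y u3 -> ~~ e u1 u3 -> e v1 v2 -> e v2 v3 -> e v1 v3 ->
     e u1 v1 && e u1 v2 && e u1 v3 && e u3 v1 && e u3 v2 -> good.
    move=> p1 p2 h1 h2 h3 h4 h5 h6 /andP[/andP[/andP[/andP[h7 h8] h9] h10] h11].
    apply: (@good_two_tri i' u1 y u3 v1 v2 v3) => //.
    apply: packing_perm ht; apply/permP => f; have /permP/(_ f) /= := p1.
    have /permP/(_ f) /= := p2; count_lia.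
  have ac : e a c by rewrite e_sym.
  have [cb ba] : e c b /\ e b a by rewrite e_sym bc e_sym ab.
  have [yx zy] : e y x /\ e z y by rewrite e_sym xy e_sym yz.
  have zx : ~~ e z x by rewrite e_sym.
  (* One labelling for each choice of the edge that may be absent among the six. *)
  have P1 := tP x z a b c (perm_refl _) (perm_refl _) xy yz xz ab bc ac.
  have P2 : _ := tP x z a c b (perm_refl _) _ xy yz xz ac cb ab.
  have P3 : _ := tP x z b c a (perm_refl _) _ xy yz xz bc ca ba.
  have Q1 : _ := tP z x a b c _ (perm_refl _) zy yx zx ab bc ac.
  have Q2 : _ := tP z x a c b _ _ zy yx zx ac cb ab.
  have Q3 : _ := tP z x b c a _ _ zy yx zx bc ca ba.
  have pzx : perm_eq [:: z; x] [:: x; z] by perm_lia.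
  have pacb : perm_eq [:: a; c; b] [:: a; b; c] by perm_lia.
  have pbca : perm_eq [:: b; c; a] [:: a; b; c] by perm_lia.
  move: P1 (P2 pacb) (P3 pbca) (Q1 pzx) (Q2 pzx pacb) (Q3 pzx pbca).
  case: (e x a); case: (e x b); case: (e x c); case: (e z a); case: (e z b); case: (e z c) => //=;
    by auto.
case: jj' hq => <- hq; move: hFq; rewrite !edges_to_cons edges_to_nil => hFq.
have [hx|hx] := ltnP 2 (count (e x) q); first exact: (good_quad_tri ir pq hq).
apply: (@good_quad_tri i x z y q) => //; last by move: hFq hx; rewrite /=; clear; lia.
by apply: packing_perm hq; apply/permP => f; rewrite /= !count_cat /=; count_lia.
Qed.

(** * Two disjoint four-vertex paths *)

Lemma sum_missing (val : edge -> bool) U :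
  \sum_(x <- U) val x + missing (fun=> 1) val U = size U.
Proof.
rewrite /missing -big_split -sum1_size; apply: eq_bigr => x _.
by case: (val x).
Qed.

Lemma good_P4P4_quad i a b c d a' b' c' d' p0 p1 p2 p3 : i.+2 = s ->
  packing r i ([:: a; b; c; d; a'; b'; c'; d'] ++ [:: p0; p1; p2; p3]) ->
  e a b -> e b c -> e c d -> e a' b' -> e b' c' -> e c' d' ->
  e p0 p1 -> e p1 p2 -> e p2 p3 -> e p3 p0 -> e a p0 && e c p0 ->
  16 < edges_to [:: a; b; c; d; a'; b'; c'; d'] [:: p0; p1; p2; p3] -> good.
Proof.
move=> is_ hp ab bc cd ab' bc' cd' p01 p12 p23 p30 /andP[ap cp] hF.
have [|||l [pl]] := exchange e_sym (x0 := x0) (isT : 2 < 4 < 5)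
  (erefl : size (nseq 8 1) = size [:: a; b; c; d; a'; b'; c'; d']) (p := [:: p0; p1; p2; p3]) _ _ _ check_P4P4_C4.
- by rewrite /piece /= p01 p12 p23 p30.
- by rewrite /= /adj_at /= ab bc cd ab' bc' cd' ap cp.
- exact: hF.
have szl := perm_size pl; move: pl szl.
case: l => [|l1 [|l2 [|l3 [|l4 [|l5 [|l6 [|l7 [|l8 l]]]]]]]] //= pl [szl].
rewrite !andbT orbF => /andP[/and4P[h12 h23 h34 h41] /and4P[h56 h67 h78 h85]].
apply: (good_size4 szl); rewrite -is_.
apply: (@packing_quad _ _ _ _ [:: l5; l6; l7; l8]); first by rewrite /piece /= h56 h67 h78 h85.
apply: (@packing_quad _ _ _ _ [:: l1; l2; l3; l4]); first by rewrite /piece /= h12 h23 h34 h41.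
by apply: packing_perm hp; rewrite perm_sym.
Qed.

Lemma three_of_P4 (p : pred T) a b c d :
  2 < p a + p b + p c + p d -> p a && p c || p b && p d.
Proof. by case: (p a); case: (p b); case: (p c); case: (p d). Qed.

(** Either the eight vertices span at least 16 edges and contain a quadrilateral, or so few of the
    edges stay inside that some piece receives at least 17. *)
Lemma good_P4P4_heavy j a b c d a' b' c' d' : j.+1 = s -> packing r j [:: a; b; c; d; a'; b'; c'; d'] ->
  e a b -> e b c -> e c d -> e a' b' -> e b' c' -> e c' d' -> heavy N [:: a; b; c; d; a'; b'; c'; d'] -> good.
Proof.
move=> js hp ab bc cd ab' bc' cd' hX.
(* Each inner edge is counted twice, so 32 means 16 edges. *)
have [hF|hF] := ltnP (edges_to [:: a; b; c; d; a'; b'; c'; d'] [:: a; b; c; d; a'; b'; c'; d']) 32; last first.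
  have [||||l [pl]] := search_sound e_sym (x0 := x0) (vs := [:: a; b; c; d; a'; b'; c'; d']) _ _ _ _ search_P4P4.
  - by [].
  - by [].
  - by rewrite /= /adj_at /= ab bc cd ab' bc' cd'.
  - set m := missing _ _ _.
    (* The 28 pairs less six path edges are 22; at least ten of them are edges, so at most 12 are
       missing. *)
    have : \sum_(x <- P4P4_vars) adj_at e x0 [:: a; b; c; d; a'; b'; c'; d'] x + m = 22 by exact: sum_missing.
    move: m => m; move: hF; rewrite !edges_to_cons edges_to_nil /= !e_irr.
    rewrite (e_sym b a) !(e_sym c a) (e_sym c b) (e_sym d a) (e_sym d b) (e_sym d c).
    rewrite (e_sym a' a) (e_sym a' b) (e_sym a' c) (e_sym a' d).
    rewrite (e_sym b' a) (e_sym b' b) (e_sym b' c) (e_sym b' d) (e_sym b' a').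
    rewrite (e_sym c' a) (e_sym c' b) (e_sym c' c) (e_sym c' d) (e_sym c' a') (e_sym c' b').
    rewrite (e_sym d' a) (e_sym d' b) (e_sym d' c) (e_sym d' d) (e_sym d' a') (e_sym d' b').
    rewrite (e_sym d' c') !big_cons big_nil /adj_at /= ab bc cd ab' bc' cd'.
    count_lia.
  have szl := perm_size pl; move: pl szl.
  case: l => [|l1 [|l2 [|l3 [|l4 l]]]] //= pl [szl].
  rewrite !andbT orbF => /and4P[h12 h23 h34 h41].
  apply: (good_size4 szl); rewrite -js.
  apply: (@packing_quad _ _ _ _ [:: l1; l2; l3; l4]); first by rewrite /piece /= h12 h23 h34 h41.
  by apply: packing_perm hp; rewrite perm_sym.
have hN : r + j + 2 = N by move: js; clear; lia.
case: (pigeonhole hp hX hN hF) => [[i' [t [ii' pt ht hFt]]]|[j' [q [jj' pq hq hFq]]]].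
  have [||l [pl]] := exchange e_sym (x0 := x0) (isT : 2 < 3 < 5)
    (erefl : size (nseq 8 1) = size [:: a; b; c; d; a'; b'; c'; d']) pt _ _ check_P4P4_K3.
  - by rewrite /= /adj_at /= ab bc cd ab' bc' cd'.
  - exact: hFt.
  have szl := perm_size pl; rewrite size_cat (eqP (proj1 (andP pt))) in szl; move: pl szl.
  case: l => [|l1 [|l2 [|l3 [|l4 [|l5 [|l6 [|l7 l]]]]]]] //= pl [szl].
  rewrite !andbT orbF => /andP[/and3P[h12 h23 h31] /and4P[h45 h56 h67 h74]].
  apply: (good_size4 szl); rewrite ii' -js.
  apply: (@packing_quad _ _ _ _ [:: l4; l5; l6; l7]); first by rewrite /piece /= h45 h56 h67 h74.
  apply: (@packing_tri _ _ _ _ [:: l1; l2; l3]); first by rewrite /piece /= h12 h23 h31.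
  by apply: packing_perm ht; rewrite perm_sym (permPl pl) (perm_catC [:: a; b; c; d; a'; b'; c'; d']).
rewrite jj' in js; move: pq hq hFq.
case: q => [|p0 [|p1 [|p2 [|p3 []]]]] // /andP[_ /= /and5P[p01 p12 p23 p30 _]] hq hFq.
have quadP u1 u2 u3 u4 v1 v2 v3 v4 q0 q1 q2 q3 :
    perm_eq ([:: u1; u2; u3; u4] ++ [:: v1; v2; v3; v4]) [:: a; b; c; d; a'; b'; c'; d'] ->
    perm_eq [:: q0; q1; q2; q3] [:: p0; p1; p2; p3] ->
    e u1 u2 -> e u2 u3 -> e u3 u4 -> e v1 v2 -> e v2 v3 -> e v3 v4 ->
    e q0 q1 -> e q1 q2 -> e q2 q3 -> e q3 q0 ->
    2 < e u1 q0 + e u2 q0 + e u3 q0 + e u4 q0 -> good.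
  move=> pu pq h1 h2 h3 h4 h5 h6 h7 h8 h9 h10.
  case/(@three_of_P4 (e^~ q0))/orP => h11.
    apply: (@good_P4P4_quad j' u1 u2 u3 u4 v1 v2 v3 v4 q0 q1 q2 q3) => //.
      apply: packing_perm hq; apply/permP => f; have /permP/(_ f) /= := pu.
      have /permP/(_ f) /= := pq; count_lia.
    by rewrite (edges_to_perm _ pu pq).
  (* Reading the first path backwards turns its fourth and second vertices into the first and
     third. *)
  have pu' : perm_eq ([:: u4; u3; u2; u1] ++ [:: v1; v2; v3; v4]) [:: a; b; c; d; a'; b'; c'; d'].
    by apply: perm_trans pu; perm_lia.
  have [s1 s2 s3] : [/\ e u4 u3, e u3 u2 & e u2 u1] by split; rewrite e_sym.
  apply: (@good_P4P4_quad j' u4 u3 u2 u1 v1 v2 v3 v4 q0 q1 q2 q3) => //.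
  - apply: packing_perm hq; apply/permP => f; have /permP/(_ f) /= := pu'.
    have /permP/(_ f) /= := pq; count_lia.
  - by rewrite andbC.
  - by rewrite (edges_to_perm _ pu' pq).
(* Of 17 edges, five end at one vertex of the quadrilateral, and three of these come from one path.
   The cycle is rotated to start at that vertex. *)
have halfP q0 q1 q2 q3 : perm_eq [:: q0; q1; q2; q3] [:: p0; p1; p2; p3] ->
    e q0 q1 -> e q1 q2 -> e q2 q3 -> e q3 q0 ->
    4 < e a q0 + e b q0 + e c q0 + e d q0 + (e a' q0 + e b' q0 + e c' q0 + e d' q0) -> good.
  move=> pq h7 h8 h9 h10 h.
  have [h1|h1] := ltnP 2 (e a q0 + e b q0 + e c q0 + e d q0).
    exact: (quadP a b c d a' b' c' d' q0 q1 q2 q3).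
  apply: (quadP a' b' c' d' a b c d q0 q1 q2 q3) => //; first by perm_lia.
  by move: h1 h; count_lia.
have [h0|h0] := ltnP 4 (e a p0 + e b p0 + e c p0 + e d p0 + (e a' p0 + e b' p0 + e c' p0 + e d' p0)).
  exact: (halfP p0 p1 p2 p3).
have [h1|h1] := ltnP 4 (e a p1 + e b p1 + e c p1 + e d p1 + (e a' p1 + e b' p1 + e c' p1 + e d' p1)).
  by apply: (halfP p1 p2 p3 p0) => //; perm_lia.
have [h2|h2] := ltnP 4 (e a p2 + e b p2 + e c p2 + e d p2 + (e a' p2 + e b' p2 + e c' p2 + e d' p2)).
  by apply: (halfP p2 p3 p0 p1) => //; perm_lia.
apply: (halfP p3 p0 p1 p2) => //; first by perm_lia.
move: h0 h1 h2 hFq; rewrite !edges_to_cons edges_to_nil /=; count_lia.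
Qed.

Lemma good_P4P4_C4 j W u1 u2 u3 u4 v1 v2 v3 v4 : j.+1 = s -> packing r j W ->
  perm_eq W [:: u1; u2; u3; u4; v1; v2; v3; v4] ->
  e u1 u2 -> e u2 u3 -> e u3 u4 -> e u4 u1 -> good.
Proof.
move=> js hp p h12 h23 h34 h41; apply: (@good_any v1 v2 v3 v4); rewrite -js.
apply: (@packing_quad _ _ _ _ [:: u1; u2; u3; u4]); first by rewrite /piece /= h12 h23 h34 h41.
exact: packing_perm hp.
Qed.

(** Each of the four tested edges closes a quadrilateral. If all are absent, the four tested pairs
    partition the eight vertices, which are therefore heavy. *)
Lemma good_P4P4_apex j a b c d a' b' c' d' : j.+1 = s -> packing r j [:: a; b; c; d; a'; b'; c'; d'] ->
  e a b -> e b c -> e c d -> e a' b' -> e b' c' -> e c' d' -> e b b' -> e b c' -> good.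
Proof.
move=> js hp ab bc cd ab' bc' cd' bb bc2.
have [h1|h1] := boolP (e b a').
  apply: (good_P4P4_C4 (u1 := b) (u2 := a') (u3 := b') (u4 := c')
    (v1 := a) (v2 := c) (v3 := d) (v4 := d') js hp) => //; rewrite 1?e_sym //; perm_lia.
have [h2|h2] := boolP (e c b').
  apply: (good_P4P4_C4 (u1 := c) (u2 := b') (u3 := c') (u4 := b)
    (v1 := a) (v2 := a') (v3 := d) (v4 := d') js hp) => //; rewrite 1?e_sym //; perm_lia.
have [h3|h3] := boolP (e d c').
  apply: (good_P4P4_C4 (u1 := d) (u2 := c') (u3 := b) (u4 := c)
    (v1 := a) (v2 := a') (v3 := b') (v4 := d') js hp) => //; rewrite 1?e_sym //; perm_lia.
have [h4|h4] := boolP (e a d').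
  apply: (good_P4P4_C4 (u1 := a) (u2 := d') (u3 := c') (u4 := b)
    (v1 := c) (v2 := a') (v3 := b') (v4 := d) js hp) => //; rewrite 1?e_sym //; perm_lia.
apply: (good_P4P4_heavy js hp) => //.
have n1 : b != a' by apply: (packing_neq (W' := [:: a; c; d; b'; c'; d']) hp); perm_lia.
have n2 : c != b' by apply: (packing_neq (W' := [:: a; b; d; a'; c'; d']) hp); perm_lia.
have n3 : d != c' by apply: (packing_neq (W' := [:: a; b; c; a'; b'; d']) hp); perm_lia.
have n4 : a != d' by apply: (packing_neq (W' := [:: b; c; d; a'; b'; c']) hp); perm_lia.
apply: heavy_perm (heavy_cat (heavy_cat (heavy_pair n1 h1) (heavy_pair n2 h2))
  (heavy_cat (heavy_pair n3 h3) (heavy_pair n4 h4))); perm_lia.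
Qed.

(** The two ends of each path are paired. The inner vertices are paired across in one of two ways;
    if both ways meet an edge, two such edges share an endpoint, adjacent to both inner vertices of
    the other path. *)
Lemma good_P4P4 j a b c d a' b' c' d' : j.+1 = s -> packing r j [:: a; b; c; d; a'; b'; c'; d'] ->
  e a b -> e b c -> e c d -> e a' b' -> e b' c' -> e c' d' -> good.
Proof.
move=> js hp ab bc cd ab' bc' cd'.
have [h1|h1] := boolP (e a d).
  apply: (good_P4P4_C4 (u1 := a) (u2 := b) (u3 := c) (u4 := d)
    (v1 := a') (v2 := b') (v3 := c') (v4 := d') js hp) => //; rewrite 1?e_sym //; perm_lia.
have [h2|h2] := boolP (e a' d').
  apply: (good_P4P4_C4 (u1 := a') (u2 := b') (u3 := c') (u4 := d')
    (v1 := a) (v2 := b) (v3 := c) (v4 := d) js hp) => //; rewrite 1?e_sym //; perm_lia.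
have n1 : a != d by apply: (packing_neq (W' := [:: b; c; a'; b'; c'; d']) hp); perm_lia.
have n2 : a' != d' by apply: (packing_neq (W' := [:: a; b; c; d; b'; c']) hp); perm_lia.
have nbb : b != b' by apply: (packing_neq (W' := [:: a; c; d; a'; c'; d']) hp); perm_lia.
have nbc : b != c' by apply: (packing_neq (W' := [:: a; c; d; a'; b'; d']) hp); perm_lia.
have ncb : c != b' by apply: (packing_neq (W' := [:: a; b; d; a'; c'; d']) hp); perm_lia.
have ncc : c != c' by apply: (packing_neq (W' := [:: a; b; d; a'; b'; d']) hp); perm_lia.
have h := heavy_cat (heavy_pair n1 h1) (heavy_pair n2 h2).
have apexP u1 u2 u3 u4 v1 v2 v3 v4 : perm_eq [:: a; b; c; d; a'; b'; c'; d'] [:: u1; u2; u3; u4; v1; v2; v3; v4] ->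
    e u1 u2 -> e u2 u3 -> e u3 u4 -> e v1 v2 -> e v2 v3 -> e v3 v4 -> e u2 v2 -> e u2 v3 -> good.
  by move=> p; apply: good_P4P4_apex js (packing_perm p hp).
have [bb|bb] := boolP (e b b'); have [cc|cc] := boolP (e c c').
- apply: (good_P4P4_C4 (u1 := b) (u2 := b') (u3 := c') (u4 := c)
    (v1 := a) (v2 := a') (v3 := d') (v4 := d) js hp) => //; rewrite 1?e_sym //; perm_lia.
- have [bc2|bc2] := boolP (e b c'); first exact: (apexP a b c d a' b' c' d').
  have [cb|cb] := boolP (e c b').
    by apply: (apexP a' b' c' d' a b c d) => //; rewrite 1?e_sym //; perm_lia.
  apply: (good_P4P4_heavy js hp) => //.
  by apply: heavy_perm (heavy_cat h (heavy_cat (heavy_pair nbc bc2) (heavy_pair ncb cb))); perm_lia.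
- have [bc2|bc2] := boolP (e b c').
    by apply: (apexP d' c' b' a' a b c d) => //; rewrite 1?e_sym //; perm_lia.
  have [cb|cb] := boolP (e c b').
    by apply: (apexP d c b a a' b' c' d') => //; rewrite 1?e_sym //; perm_lia.
  apply: (good_P4P4_heavy js hp) => //.
  by apply: heavy_perm (heavy_cat h (heavy_cat (heavy_pair nbc bc2) (heavy_pair ncb cb))); perm_lia.
- apply: (good_P4P4_heavy js hp) => //.
  by apply: heavy_perm (heavy_cat h (heavy_cat (heavy_pair nbb bb) (heavy_pair ncc cc))); perm_lia.
Qed.

End Chain.

(** * Induction on the missing edges *)

Section AddEdge.
Variables (T : finType) (e e' : rel T).
Hypothesis e_sym : symmetric e.
Hypothesis e'_sym : symmetric e'.
(** This says abstractly that [e'] has at most one edge more than [e]: away from the ends of a new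
    edge, all edges are old. *)
Hypothesis new_edge : forall u v w t,
  e' u v -> ~~ e u v -> e' w t -> w != u -> w != v -> e w t.

Lemma sub_piece k s : {in s &, subrel e' e} -> piece e' k s -> piece e k s.
Proof.
move=> sub /andP[sz cs]; rewrite /piece sz /=.
by apply: (sub_in_cycle sub) cs; apply/allP.
Qed.

Lemma broken_triangle s : uniq s -> piece e' 3 s -> ~~ piece e 3 s ->
  exists a b c, [/\ perm_eq s [:: a; b; c], e a b, e b c, ~~ e a c & e' a c].
Proof.
case: s => [|a [|b [|c []]]] //; rewrite /piece /= !inE !negb_or !andbT.
move=> /andP[/andP[nab nac] nbc] /and3P[ab bc ca].
have brk u v w : perm_eq [:: a; b; c] [:: u; w; v] -> e' u v -> ~~ e u v -> e' w u -> e' w v ->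
    w != u -> w != v -> exists a0 b0 c0,
    [/\ perm_eq [:: a; b; c] [:: a0; b0; c0], e a0 b0, e b0 c0, ~~ e a0 c0 & e' a0 c0].
  move=> p uv nuv wu wv h1 h2; exists u, w, v; split=> //.
    by rewrite e_sym; apply: (new_edge uv nuv).
  exact: (new_edge uv nuv).
rewrite !negb_and => /or3P[h|h|h].
- by apply: (brk a b c) => //; rewrite 1?e'_sym 1?eq_sym //; perm_lia.
- by apply: (brk b c a) => //; rewrite 1?e'_sym 1?eq_sym //; perm_lia.
- by apply: (brk c a b) => //; rewrite 1?e'_sym 1?eq_sym //; perm_lia.
Qed.

Lemma broken_quad s : uniq s -> piece e' 4 s -> ~~ piece e 4 s ->
  exists a b c d, [/\ perm_eq s [:: a; b; c; d], e a b, e b c, e c d & ~~ e a d /\ e' a d].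
Proof.
case: s => [|a [|b [|c [|d []]]]] //; rewrite /piece /= !inE !negb_or !andbT.
move=> /and3P[/and3P[nab nac nad] /andP[nbc nbd] ncd] /and4P[ab bc cd da].
have brk u v w t : perm_eq [:: a; b; c; d] [:: u; v; w; t] ->
    e' u v -> e' v w -> e' w t -> e' t u -> ~~ e t u -> v != u -> v != t -> w != u -> w != t ->
    exists a0 b0 c0 d0, [/\ perm_eq [:: a; b; c; d] [:: a0; b0; c0; d0],
      e a0 b0, e b0 c0, e c0 d0 & ~~ e a0 d0 /\ e' a0 d0].
  move=> p uv vw wt tu ntu h1 h2 h3 h4; exists u, v, w, t; split=> //.
  - by rewrite e_sym; apply: (new_edge tu ntu); rewrite // e'_sym.
  - exact: (new_edge tu ntu).
  - exact: (new_edge tu ntu).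
  - by rewrite e_sym e'_sym.
rewrite !negb_and => /or4P[h|h|h|h].
- by apply: (brk b c d a) => //; rewrite 1?eq_sym //; perm_lia.
- by apply: (brk c d a b) => //; rewrite 1?eq_sym //; perm_lia.
- by apply: (brk d a b c) => //; rewrite 1?eq_sym //; perm_lia.
- by apply: (brk a b c d) => //; rewrite 1?eq_sym //; perm_lia.
Qed.

Variables (x0 : T) (r s : nat).
Hypothesis e_irr : irreflexive e.
Hypothesis sigma : forall x y, x != y -> ~~ e x y -> 4 * (r + s.+1) <= deg e x + deg e y.

(** If no piece breaks, the leftover is improved afresh, whatever became of [D]. If one breaks, [D]
    is intact: a [C4] there can serve as a quadrilateral and the triangle of a [paw] as a
    triangle. *)
Lemma good_remove_edge : good e' x0 r s -> good e x0 r s.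
Proof.
move=> [a [b [c [d [[tl [ql [szt szq at_ aq p]]] hD]]]]].
have uall : uniq (flatten tl ++ flatten ql ++ [:: a; b; c; d]) by rewrite (perm_uniq p) enum_uniq.
have restore u v (R : seq T) : e' u v -> ~~ e u v -> u \notin R -> v \notin R -> {in R &, subrel e' e}.
  move=> uv nuv uR vR w t wR _ wt; apply: (new_edge uv nuv wt).
    by apply: contraNneq uR => <-.
  by apply: contraNneq vR => <-.
have sub_flat (tl' : seq (seq T)) (R : seq T) k : {subset flatten tl' <= R} -> {in R &, subrel e' e} ->
    all (piece e' k) tl' -> all (piece e k) tl'.
  move=> sub hR /allP h; apply/allP => s' s'in; apply: sub_piece (h _ s'in).
  by move=> w t wi ti; apply: hR; apply: sub; apply/flattenP; exists s'.
have hD' : {in [:: a; b; c; d] &, subrel e' e} ->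
    has (fun ps => realize x0 e ps [:: a; b; c; d]) [:: [:: C4]; [:: paw]].
  move=> sub; move: hD; rewrite /= !andbT !orbF.
  have sub2 u v : u \in [:: a; b; c; d] -> v \in [:: a; b; c; d] -> e' u v -> e u v by exact: sub.
  have [ma mb mc md] : [/\ a \in [:: a; b; c; d], b \in [:: a; b; c; d],
      c \in [:: a; b; c; d] & d \in [:: a; b; c; d]] by split; rewrite !inE eqxx ?orbT.
  case/orP => /and4P[/(sub2 _ _ ma mb)-> /(sub2 _ _ mb mc)->].
    by move=> /(sub2 _ _ mc md)-> /(sub2 _ _ md ma)->.
  by move=> /(sub2 _ _ mc ma)-> /(sub2 _ _ mc md)->; rewrite orbT.
have [at2|/allPn[t tin bt]] := boolP (all (piece e 3) tl).
  have [aq2|/allPn[q qin bq]] := boolP (all (piece e 4) ql).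
    by apply: (good_any _ e_sym e_irr sigma (a := a) (b := b) (c := c) (d := d)); exists tl, ql.
  have pq := perm_flatten (perm_to_rem qin).
  set R := flatten tl ++ flatten (rem q ql) ++ [:: a; b; c; d].
  have pR : perm_eq (q ++ R) (flatten tl ++ flatten ql ++ [:: a; b; c; d]).
    by apply/permP => f; move/permP/(_ f): pq; rewrite /R /= !count_cat /=; count_lia.
  have uqR : uniq (q ++ R) by rewrite (perm_uniq pR).
  have := uqR; rewrite cat_uniq => /and3P[uq nqR _].
  have [q1 [q2 [q3 [q4 [pq4 h12 h23 h34 [n14 h14]]]]]] := broken_quad uq (allP aq _ qin) bq.
  have qR y : y \in q -> y \notin R.
    by move=> yq; apply: contra nqR => yR; apply/hasP; exists y.
  have hR : {in R &, subrel e' e}.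
    by apply: (restore q1 q4 R) => //; apply: qR; rewrite (perm_mem pq4) !inE eqxx ?orbT.
  have aq2 : all (piece e 4) (rem q ql).
    apply: (sub_flat _ R) => //; first by move=> y yi; rewrite !mem_cat yi orbT.
    by apply/allP => s' /mem_rem /(allP aq).
  case: s sigma szq {hD at_} hD' => [|j] sigma' szq hD'; first by case: (ql) qin szq.
  have hp : packing e r j ([:: q1; q2; q3; q4] ++ [:: a; b; c; d]).
    exists tl, (rem q ql); split=> //; first by rewrite size_rem // szq.
    apply: perm_trans p; apply: perm_trans pR; apply/permP => f.
    by move/permP/(_ f): pq4; rewrite /R !count_cat /= => ->; count_lia.
  have : has (fun ps => realize x0 e ps [:: a; b; c; d]) [:: [:: C4]; [:: paw]].
    by apply: hD' => w u wi ui; apply: hR; rewrite !mem_cat ?wi ?ui !orbT.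
  rewrite /= !andbT !orbF => /orP[] /and4P[h1 h2 h3 h4].
    apply: (good_any _ e_sym e_irr sigma' (a := q1) (b := q2) (c := q3) (d := q4)).
    apply: (@packing_quad _ _ _ _ [:: a; b; c; d]); first by rewrite /piece /= h1 h2 h3 h4.
    by apply: packing_perm hp; perm_lia.
  (* The [paw] contains the path [a], [b], [c], [d]. *)
  exact: (good_P4P4 _ e_sym e_irr sigma' erefl hp h12 h23 h34 h1 h2 h4).
have pt := perm_flatten (perm_to_rem tin).
set R := flatten (rem t tl) ++ flatten ql ++ [:: a; b; c; d].
have pR : perm_eq (t ++ R) (flatten tl ++ flatten ql ++ [:: a; b; c; d]).
  by apply/permP => f; move/permP/(_ f): pt; rewrite /R /= !count_cat /=; count_lia.
have uqR : uniq (t ++ R) by rewrite (perm_uniq pR).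
have := uqR; rewrite cat_uniq => /and3P[ut ntR _].
have [x [y [z [pt3 xy yz xz xz']]]] := broken_triangle ut (allP at_ _ tin) bt.
have tR u : u \in t -> u \notin R.
  by move=> yq; apply: contra ntR => yR; apply/hasP; exists u.
have hR : {in R &, subrel e' e}.
  by apply: (restore x z R) => //; apply: tR; rewrite (perm_mem pt3) !inE eqxx ?orbT.
have at2 : all (piece e 3) (rem t tl).
  apply: (sub_flat _ R) => //; first by move=> u ui; rewrite !mem_cat ui.
  by apply/allP => s' /mem_rem /(allP at_).
have aq2 : all (piece e 4) ql.
  by apply: (sub_flat _ R) => //; move=> u ui; rewrite !mem_cat ui orbT.
have hp : packing e (size tl).-1 s ([:: x; y; z] ++ [:: a; b; c; d]).
  exists (rem t tl), ql; split=> //; first by rewrite size_rem.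
  apply: perm_trans p; apply: perm_trans pR; apply/permP => f.
  by move/permP/(_ f): pt3; rewrite /R !count_cat /= => ->; count_lia.
have rE : (size tl).-1.+1 = r by case: (tl) tin szt.
have : has (fun ps => realize x0 e ps [:: a; b; c; d]) [:: [:: C4]; [:: paw]].
  by apply: hD' => w u wi ui; apply: hR; rewrite !mem_cat ?wi ?ui !orbT.
rewrite /= !andbT !orbF => /orP[] /and4P[h1 h2 h3 h4].
  (* Counting [D] as a quadrilateral gives [s.+1] of them, and only the path [x], [y], [z] is left
     over. *)
  apply: (good_broken_tri _ e_sym e_irr sigma rE _ xy yz xz).
  apply: (@packing_quad _ _ _ _ [:: a; b; c; d]); first by rewrite /piece /= h1 h2 h3 h4.
  by apply: packing_perm hp; perm_lia.
apply: (good_any _ e_sym e_irr sigma (a := d) (b := x) (c := y) (d := z)).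
rewrite -rE; apply: (@packing_tri _ _ _ _ [:: a; b; c]); first by rewrite /piece /= h1 h2 h3.
by apply: packing_perm hp; perm_lia.
Qed.
End AddEdge.

(** * Complete graphs and the induction *)

Section Main.
Variables (T : finType) (x0 : T) (r s : nat).

(** Any three or four vertices form a piece, so pieces are cut off greedily, triangles first. *)
Lemma good_complete (e : rel T) : (forall x y, x != y -> e x y) ->
  #|T| = 3 * r + 4 * s.+1 -> good e x0 r s.
Proof.
move=> eT cardT.
have cyc W W' : uniq (W ++ W') -> 1 < size W <= 4 -> cycle e W.
  case: W => [|a [|b [|c [|d []]]]] //=; rewrite !inE ?negb_or.
  - by move=> /andP[/andP[nab _] _] _; rewrite !eT // eq_sym.
  - case/and3P=> /and3P[nab nac _] /andP[nbc _] _ _.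
    by rewrite !eT // eq_sym.
  - case/and4P=> /and4P[nab nac nad _] /and3P[nbc nbd _] /andP[ncd _] _ _.
    by rewrite !eT // eq_sym.
have tris i : i <= r -> exists W, packing e i 0 W /\ size W = 3 * r + 4 * s.+1 - 3 * i.
  elim: i => [_|i IH lei].
    exists (enum T); split; last by rewrite -cardE cardT subn0.
    by exists [::], [::]; split.
  have [W [pW szW]] := IH (ltnW lei).
  case: W pW szW => [|a [|b [|c W]]] /= pW szW; try (exfalso; clear -szW lei; lia).
  exists W; split; last by clear -szW; lia.
  apply: (@packing_tri _ _ _ _ [:: a; b; c]) => //.
  by rewrite /piece (cyc _ W) //; apply: (packing_uniq pW).
have quads j : j <= s -> exists W, packing e r j W /\ size W = 4 * s.+1 - 4 * j.
  elim: j => [_|j IH lej].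
    by have [W [pW szW]] := tris r (leqnn r); exists W; split=> //; clear -szW; lia.
  have [W [pW szW]] := IH (ltnW lej).
  case: W pW szW => [|a [|b [|c [|d W]]]] /= pW szW; try (exfalso; clear -szW lej; lia).
  exists W; split; last by clear -szW; lia.
  apply: (@packing_quad _ _ _ _ [:: a; b; c; d]) => //.
  by rewrite /piece (cyc _ W) //; apply: (packing_uniq pW).
have [W [pW szW]] := quads s (leqnn s).
case: W pW szW => [|a [|b [|c [|d [|? ?]]]]] /= pW szW; try (exfalso; clear -szW; lia).
exists a, b, c, d; split=> //.
have /= : cycle e [:: a; b; c; d] by rewrite (cyc _ [::]) // cats0 (packing_uniq pW).
by move=> ->.
Qed.

Lemma good_exists (e : rel T) : symmetric e -> irreflexive e ->
  (forall x y, x != y -> ~~ e x y -> 4 * (r + s.+1) <= deg e x + deg e y) ->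
  #|T| = 3 * r + 4 * s.+1 -> good e x0 r s.
Proof.
(* The diagonal is counted too; this constant share does not disturb the descent. *)
have [n] := ubnP #|[set p : T * T | ~~ e p.1 p.2]|.
elim: n e => // n IH e lt_n e_sym e_irr sigma cardT.
have [/existsP[x /existsP[z /andP[nxz exz]]]|compl] :=
    boolP [exists x, exists z, (x != z) && ~~ e x z]; last first.
  apply: good_complete => // x y nxy; apply: contraNT compl => exy.
  by apply/existsP; exists x; apply/existsP; exists y; rewrite nxy.
pose e' u v := [|| e u v, (u == x) && (v == z) | (u == z) && (v == x)].
have sub u v : e u v -> e' u v by rewrite /e' => ->.
have e'_sym : symmetric e'.
  by move=> u v; rewrite /e' e_sym; congr (_ || _); rewrite orbC andbC [(v == z) && _]andbC.
have e'_irr : irreflexive e'.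
  move=> u; rewrite /e' e_irr /= [(u == z) && _]andbC orbb; apply/negP => /andP[/eqP-> /eqP xz].
  by rewrite xz eqxx in nxz.
apply: (@good_remove_edge T e e') => //.
  move=> u v w t; rewrite /e' => h /negPf nuv; move: h; rewrite nuv /=.
  case/orP => /andP[/eqP-> /eqP->] + wx wz; rewrite (negPf wx) (negPf wz) /= orbF //.
apply: IH => //.
- rewrite -ltnS; apply: leq_trans lt_n; rewrite ltnS; apply: proper_card; apply/properP; split.
    by apply/subsetP => p; rewrite !inE; apply: contra; exact: sub.
  by exists (x, z); rewrite !inE //= /e' !eqxx orbT.
(* Degrees only grow and no new nonadjacent pair arises, so the degree condition persists. *)
- move=> u v nuv euv.
  have degS w : deg e w <= deg e' w.
    by apply: subset_leq_card; apply/subsetP => y; rewrite !inE; exact: sub.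
  apply: leq_trans (leq_add (degS u) (degS v)); apply: sigma => //.
  by apply: contra euv; exact: sub.
Qed.

End Main.

(** * From lists to indexed families *)

Lemma edges4_ge (T : finType) (e : rel T) (d : 'I_4 -> T) (ps : seq ('I_4 * 'I_4)) :
  uniq ps -> all (fun p : 'I_4 * 'I_4 => (p.1 < p.2) && e (d p.1) (d p.2)) ps -> size ps <= edges4 e d.
Proof.
move=> ups /allP h; rewrite /edges4 cardE; apply: uniq_leq_size => // p /h hp.
by rewrite mem_enum inE.
Qed.

Theorem theorem1 (T : finType) (e : rel T) (r s : nat) :
  simple_graph e ->
  0 < r -> 0 < s ->
  #|T| = 3 * r + 4 * s ->
  sigma2_ge e (#|T| + r) ->
  exists (t : 'I_r -> 'I_3 -> T) (q : 'I_(s.-1) -> 'I_4 -> T) (d : 'I_4 -> T),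
    [/\ injective (all_vertices t q d),
        forall i, is_triangle e (t i),
        forall i, is_quad e (q i)
      & 4 <= edges4 e d].
Proof.
move=> [e_sym e_irr] _; case: s => // s _ cardT sigma /=.
have /card_gt0P[x0 _] : 0 < #|T| by rewrite cardT; lia.
have [|a [b [c [d [[tl [ql [szt szq at_ aq p]]] hD]]]]] := good_exists x0 e_sym e_irr _ cardT.
  (* The order plus [r] is [4 * (r + s.+1)]. *)
  move=> x y nxy nexy; apply: leq_trans (sigma x y nxy nexy); rewrite cardT; lia.
pose D := [:: a; b; c; d].
exists (fun i j => nth x0 (nth [::] tl i) j), (fun i j => nth x0 (nth [::] ql i) j),
  (fun j => nth x0 D j).
split.
(* The labelling is onto because the packing exhausts [T]; there are as many labels as vertices, so
   it is injective. *)
- set f := all_vertices _ _ _; apply/injectiveP; rewrite /injectiveb /dinjectiveb.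
  apply: (leq_size_uniq (enum_uniq T)); last first.
    by rewrite size_image -cardE cardT card_sum card_prod card_sum card_prod !card_ord; lia.
  move=> x; rewrite -(perm_mem p) !mem_cat => /or3P[/flattenP[t tin xt]|/flattenP[q qin xq]|xD].
  + have hi : index t tl < r by rewrite -szt index_mem.
    have hj : index x t < 3.
      by rewrite -(eqP (proj1 (andP (allP at_ _ tin)))) index_mem.
    apply/codomP; exists (inl (Ordinal hi, Ordinal hj)) => /=.
    by rewrite !nth_index.
  + have hi : index q ql < s by rewrite -szq index_mem.
    have hj : index x q < 4.
      by rewrite -(eqP (proj1 (andP (allP aq _ qin)))) index_mem.
    apply/codomP; exists (inr (inl (Ordinal hi, Ordinal hj))) => /=.
    by rewrite !nth_index.
  + have hj : index x D < 4 by rewrite -[4]/(size D) index_mem.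
    by apply/codomP; exists (inr (inr (Ordinal hj))); rewrite /= nth_index.
- move=> i; have : piece e 3 (nth [::] tl i) by apply: (allP at_); rewrite mem_nth // szt.
  move: (nth [::] tl i) => [|u [|v [|w []]]] // /andP[_ /= /and4P[uv vw wu _]].
  move=> [[|[|[|j]]] hj] [[|[|[|k]]] hk] //= _; by rewrite // e_sym.
- move=> i; have : piece e 4 (nth [::] ql i) by apply: (allP aq); rewrite mem_nth // szq.
  move: (nth [::] ql i) => [|u [|v [|w [|t []]]]] // /andP[_ /= /and5P[uv vw wt tu _]].
  by move=> [[|[|[|[|j]]]] hj].
have [o0 o1 o2 o3] : [/\ 0 < 4, 1 < 4, 2 < 4 & 3 < 4] by [].
(* [edges4] counts increasing pairs, so the edge that closes the cycle is reversed by symmetry. *)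
move: hD; rewrite /= !andbT !orbF => /orP[] /and4P[h1 h2 h3 h4].
  apply: (@edges4_ge _ _ _ [:: (Ordinal o0, Ordinal o1); (Ordinal o1, Ordinal o2);
    (Ordinal o2, Ordinal o3); (Ordinal o0, Ordinal o3)]) => //.
  by rewrite /= h1 h2 h3 e_sym h4.
apply: (@edges4_ge _ _ _ [:: (Ordinal o0, Ordinal o1); (Ordinal o1, Ordinal o2);
  (Ordinal o0, Ordinal o2); (Ordinal o2, Ordinal o3)]) => //.
by rewrite /= h1 h2 h4 e_sym h3.
Qed.
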